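(* Assume that the events $\bigcup_{j=0}^N\{V_{t_j+}=P_{t_j}\}$ and $\bigcup_{j=0}^N\{V_{t_j+}=R_{t_j}\}$ have probability zero. Then for any $t\in[0,T]$, as $\lambda\downarrow0$, the pair $(\tau^\lambda_t,\sigma^\lambda_t)$ converges almost surely to $(\tau_t,\sigma_t)$.
   Context: Setting. $(\Omega,\mathcal F,\mathbb P,\mathbb F)$ is a filtered probability space whose filtration $\mathbb F=(\mathcal F_t)_{t\ge0}$ satisfies the usual conditions; martingales are càdlàg. $T>0$, $S=\{t_0,t_1,\dots,t_N\}$ with $0=t_0<t_1<\dots<t_N<T$, and $t_{N+1}:=T$. $\mathcal T_{t,T}(S)$ is the set of $\mathbb F$-stopping times with values in $(S\cup\{T\})\cap[t,T]$. $X_{t+}$ denotes the right limit of a process $X$ at $t$. $P$ and $R$ are $\mathbb F$-adapted processes, $P\ge0$, with $R>P$ on $S$, $R_T=P_T$, $\max_{u\in S\cup\{T\}}\mathbb E[P_u]<\infty$ and $\max_{u\in S\cup\{T\}}\mathbb E[R_u]<\infty$. Bermudan game value. $V_t=\operatorname{ess\,sup}_{\tau\in\mathcal T_{t,T}(S)}\operatorname{ess\,inf}_{\sigma\in\mathcal T_{t,T}(S)}\mathbb E[P_\tau\mathbf 1_{\{\tau\le\sigma\}}+R_\sigma\mathbf 1_{\{\tau>\sigma\}}|\mathcal F_t]$; it satisfies $V_t=P_T-(M_T-M_t)+\sum_{t\le t_i<T}\{(P_{t_i}-V_{t_i+})^+-(V_{t_i+}-R_{t_i})^+\}$ with $M$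 a uniformly integrable martingale. The optimal stopping times are $$\tau_t=\inf\{s\in S\cup\{T\}:s\ge t,\ V_s=P_s\},\qquad\sigma_t=\inf\{s\in S\cup\{T\}:s\ge t,\ V_s=R_s\}.$$ Entropy-regularised game value. For $x\ne0$, $\Psi(x)=\frac1x\ln\big(\frac{e^x-1}{x}\big)$, $\Psi(0)=\frac12$, $\Phi(x)=x\Psi(x)$. For $\lambda>0$, $(V^\lambda,M^\lambda)$ is the unique pair ($V^\lambda$ of class (D), $M^\lambda$ a uniformly integrable martingale started at $0$) solving $V^\lambda_t=P_T-(M^\lambda_T-M^\lambda_t)+\sum_{t\le t_i<T}\{\lambda\Phi(\lambda^{-1}(P_{t_i}-V^\lambda_{t_i+}))-\lambda\Phi(\lambda^{-1}(V^\lambda_{t_i+}-R_{t_i}))\}$, $t\in[0,T]$. Randomised stopping times. Let $U_1,U_2$ be independent uniform random variables on $[0,1]$, independent of $\mathcal F_\infty$. Put, for $i=0,\dots,N$, $\Delta\Gamma^{P,\lambda}_{t_i}=\Psi(\lambda^{-1}(P_{t_i}-V^\lambda_{t_i+}))$ and $\Delta\Gamma^{R,\lambda}_{t_i}=\Psi(\lambda^{-1}(V^\lambda_{t_i+}-R_{t_i}))$, and for $t\le s$ and $\Gamma\in\{\Gamma^{P,\lambda},\Gamma^{R,\lambda}\}$ put $\mathcal E_{t,s}(-\Gamma_-)=\prod_{i:\ t\le t_i<s}(1-\Delta\Gamma_{t_i})$ (empty product $=1$). Then $$\tau^\lambda_t=\inf\{s\ge t:1-\mathcal E_{t,s}(-\Gamma^{P,\lambda}_-)\ge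 U_1\}\wedge T,\qquad\sigma^\lambda_t=\inf\{s\ge t:1-\mathcal E_{t,s}(-\Gamma^{R,\lambda}_-)\ge U_2\}\wedge T,$$ with $\inf\emptyset=+\infty$.
   Formalization: Since each V^λ is unique only up to null sets, convergence as λ↓0 is claimed almost surely along every countable set of λ for arbitrary versions, and over all real λ↓0 only when the versions of V^λ at t_i+ are almost surely continuous in λ>0. *)

(* Defs.v *)
From HB Require Import structures.
From mathcomp Require Import all_boot all_order all_algebra.
From mathcomp Require Import all_classical all_reals all_analysis.

Set Implicit Arguments.
Unset Strict Implicit.
Unset Printing Implicit Defensive.

Import Order.TTheory GRing.Theory Num.Theory.
Import numFieldNormedType.Exports.

Local Open Scope classical_set_scope.
Local Open Scope ring_scope.

Section stochastic_basis.
Context {R : realType} {d : measure_display} {Omega : measurableType d}.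
Variable Pr : probability Omega R.
Implicit Types (F : R -> set_system Omega) (X M V : R -> Omega -> R).

(* Only the indices t >= 0 matter. Completeness is with respect to
   [negligible], i.e. subsets of null events, so it also makes the probability
   space itself complete. *)
Record usual_filtration F : Prop := UsualFiltration {
  filtration_sigma_algebra : forall t, 0 <= t -> sigma_algebra setT (F t);
  filtration_measurable : forall t, 0 <= t -> F t `<=` measurable;
  filtration_nondecreasing : forall s t, 0 <= s -> s <= t -> F s `<=` F t;
  filtration_right_continuous : forall t, 0 <= t ->
    \bigcap_(s in [set s | t < s]) F s `<=` F t;
  filtration_complete : forall A, Pr.-negligible A -> F 0 A }.

Definition filtration_oo F : set_system Omega :=
  <<s \bigcup_(t in [set t | 0 <= t]) F t >>.

(* For a sigma-algebra G, the measurable sets of [g_sigma_algebraType G] are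
   exactly the elements of G. *)
Definition measurable_wrt (G : set_system Omega) (Y : Omega -> R) : Prop :=
  measurable_fun [set: g_sigma_algebraType G] (Y : g_sigma_algebraType G -> R).

Definition adapted F (T : R) X : Prop :=
  forall t, 0 <= t <= T -> measurable_wrt (F t) (X t).

(* Y is a version of E[Z | G]. *)
Definition is_condexp (G : set_system Omega) (Z Y : Omega -> R) : Prop :=
  [/\ measurable_wrt G Y,
      Pr.-integrable setT (EFin \o Y) &
      forall A, G A -> (\int[Pr]_(w in A) (Y w)%:E = \int[Pr]_(w in A) (Z w)%:E)%E].

Definition is_ess_sup (fam : set (Omega -> R)) (Z : Omega -> R) : Prop :=
  [/\ measurable_fun setT Z,
      forall Y, fam Y -> {ae Pr, forall w, Y w <= Z w} &
      forall Z' : Omega -> R, measurable_fun setT Z' ->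
        (forall Y, fam Y -> {ae Pr, forall w, Y w <= Z' w}) ->
        {ae Pr, forall w, Z w <= Z' w}].

Definition is_ess_inf (fam : set (Omega -> R)) (Z : Omega -> R) : Prop :=
  [/\ measurable_fun setT Z,
      forall Y, fam Y -> {ae Pr, forall w, Z w <= Y w} &
      forall Z' : Omega -> R, measurable_fun setT Z' ->
        (forall Y, fam Y -> {ae Pr, forall w, Z' w <= Y w}) ->
        {ae Pr, forall w, Z' w <= Z w}].

Definition stopping_time F (tau : Omega -> R) : Prop :=
  forall s, 0 <= s -> F s [set w | tau w <= s].

Definition uniformly_integrable (fam : set (Omega -> R)) : Prop :=
  (forall Y, fam Y -> measurable_fun setT Y) /\
  (fun c : R => ereal_sup
     [set (\int[Pr]_(w in [set w | (c < `|Y w|)%R]) (`|Y w|%R)%:E)%E | Y in fam])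
    @ +oo --> (0 : \bar R)%E.

Definition class_D F (T : R) X : Prop :=
  uniformly_integrable
    [set (fun w => X (tau w) w) | tau in
       [set tau | stopping_time F tau /\ forall w, 0 <= tau w <= T]].

Definition cadlag (T : R) (x : R -> R) : Prop :=
  (forall t, 0 <= t < T -> x s @[s --> t^'+] --> x t) /\
  (forall t, 0 < t <= T -> cvg (x s @[s --> t^'-])).

Definition ui_martingale F (T : R) M : Prop :=
  [/\ adapted F T M,
      forall s t, 0 <= s -> s <= t -> t <= T -> is_condexp (F s) (M t) (M s),
      uniformly_integrable [set M t | t in [set t | 0 <= t <= T]] &
      {ae Pr, forall w, cadlag T (M^~ w)}].

(* Meaningful when the limit exists, which [backward_equation] below together
   with the cadlag paths of M guarantees almost surely at every ts i. *)
Definition right_limit X (t : R) (w : Omega) : R := lim (X s w @[s --> t^'+]).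

Definition mutually_independent3 (U1 U2 : Omega -> R) (G : set_system Omega) :
    Prop :=
  forall (A B : set R) (C : set Omega), measurable A -> measurable B -> G C ->
    (Pr (U1 @^-1` A `&` U2 @^-1` B `&` C) =
     Pr (U1 @^-1` A) * Pr (U2 @^-1` B) * Pr C)%E.

Definition uniform01 (U : {RV Pr >-> R}) : Prop :=
  forall A : set R, measurable A ->
    distribution Pr U A = uniform_prob (@ltr01 R) A.

End stochastic_basis.

Section game.
Context {R : realType} {d : measure_display} {Omega : measurableType d}.
Variable Pr : probability Omega R.
Variables (F : R -> set_system Omega) (T : R) (N : nat) (ts : 'I_N.+1 -> R).
Variables payP payR : R -> Omega -> R.
Implicit Types (V M : R -> Omega -> R).

(* S \cup {T}, where S is the set of the exercise dates ts i. *)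
Definition exercise_dates : set R := range ts `|` [set T].

Definition admissible (t : R) : set (Omega -> R) :=
  [set tau | stopping_time F tau /\
     forall w, exercise_dates (tau w) /\ t <= tau w <= T].

Definition game_payoff (tau sigma : Omega -> R) (w : Omega) : R :=
  if tau w <= sigma w then payP (tau w) w else payR (sigma w) w.

(* ess inf over sigma of E[game_payoff tau sigma | F_t]. *)
Definition is_lower_payoff (t : R) (tau Y : Omega -> R) : Prop :=
  is_ess_inf Pr
    [set Z | exists2 sigma, admissible t sigma &
             is_condexp Pr (F t) (game_payoff tau sigma) Z] Y.

Definition is_game_value V : Prop :=
  adapted F T V /\
  forall t, 0 <= t <= T ->
    is_ess_sup Pr
      [set Y | exists2 tau, admissible t tau & is_lower_payoff t tau Y] (V t).

(* V_t = P_T - (M_T - M_t) + \sum_(t <= t_i < T) g (P_{t_i}) (R_{t_i}) (V_{t_i+})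
   for all t in [0, T], almost surely. *)
Definition backward_equation (g : R -> R -> R -> R) V M : Prop :=
  {ae Pr, forall w, forall t, 0 <= t <= T ->
    V t w = payP T w - (M T w - M t w) +
      \sum_(i < N.+1 | t <= ts i < T)
         g (payP (ts i) w) (payR (ts i) w) (right_limit V (ts i) w)}.

Definition reflection (p r v : R) : R := Num.max (p - v) 0 - Num.max (v - r) 0.

(* The stopping times below are extended-real-valued so that the infimum of the
   empty set is +oo. *)
Definition optimal_buyer V (t : R) (w : Omega) : \bar R :=
  ereal_inf [set s%:E | s in
    [set s | exercise_dates s /\ t <= s /\ V s w = payP s w]].

Definition optimal_seller V (t : R) (w : Omega) : \bar R :=
  ereal_inf [set s%:E | s in
    [set s | exercise_dates s /\ t <= s /\ V s w = payR s w]].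

Definition Psi (x : R) : R :=
  if x == 0 then 2^-1 else x^-1 * ln ((expR x - 1) / x).

Definition Phi (x : R) : R := x * Psi x.

Definition entropy_reflection (lambda p r v : R) : R :=
  lambda * Phi (lambda^-1 * (p - v)) - lambda * Phi (lambda^-1 * (v - r)).

Definition is_entropy_solution (lambda : R) V M : Prop :=
  [/\ adapted F T V /\ class_D Pr F T V,
      ui_martingale Pr F T M,
      {ae Pr, forall w, M 0 w = 0} &
      backward_equation (entropy_reflection lambda) V M].

Definition dGammaP (lambda : R) V (i : 'I_N.+1) (w : Omega) : R :=
  Psi (lambda^-1 * (payP (ts i) w - right_limit V (ts i) w)).

Definition dGammaR (lambda : R) V (i : 'I_N.+1) (w : Omega) : R :=
  Psi (lambda^-1 * (right_limit V (ts i) w - payR (ts i) w)).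

Definition survival (dGamma : 'I_N.+1 -> Omega -> R) (t s : R) (w : Omega) : R :=
  \prod_(i < N.+1 | t <= ts i < s) (1 - dGamma i w).

Definition randomised_time (dGamma : 'I_N.+1 -> Omega -> R) (U : Omega -> R)
    (t : R) (w : Omega) : \bar R :=
  Order.min
    (ereal_inf [set s%:E | s in
       [set s | t <= s /\ U w <= 1 - survival dGamma t s w]])
    T%:E.

Definition entropy_buyer (lambda : R) V (U1 : Omega -> R) :=
  randomised_time (dGammaP lambda V) U1.

Definition entropy_seller (lambda : R) V (U2 : Omega -> R) :=
  randomised_time (dGammaR lambda V) U2.

(* Each V^lambda is unique only up to indistinguishability, so for uncountably
   many lambda an almost sure limit depends on the versions chosen: changing
   V^lambda on a null set N_lambda can destroy convergence on the union of the
   N_lambda. This predicate singles out the choices of versions that are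
   almost surely continuous in lambda > 0, for which the limit over all
   lambda > 0 is meaningful. *)
Definition lambda_continuous (Vl : R -> R -> Omega -> R) : Prop :=
  {ae Pr, forall w, forall (i : 'I_N.+1) (lambda : R), 0 < lambda ->
    {for lambda, continuous (fun l => right_limit (Vl l) (ts i) w)}}.

End game.

(* Main.v *)
Require Import Defs.
From HB Require Import structures.
From mathcomp Require Import all_boot all_order all_algebra.
From mathcomp Require Import all_classical all_reals all_analysis.
From mathcomp Require Import measurable_realfun ring lra.

Set Implicit Arguments.
Unset Strict Implicit.
Unset Printing Implicit Defensive.

Import Order.TTheory GRing.Theory Num.Theory.
Import numFieldNormedType.Exports.

Local Open Scope classical_set_scope.
Local Open Scope ring_scope.

(** Write v_i for the right limit of V at t_i and v_i^l for that of V^l, where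
    l > 0 is the regularisation parameter.

    Convergence of the times given convergence of the right limits. When
    v_i^l -> v_i and v_i is neither P_{t_i} nor R_{t_i}, the arguments of Psi
    in the jumps of Gamma^P and Gamma^R go to plus or minus infinity, so each
    jump tends to 1 or to 0: to 1 exactly at the dates where the unregularised
    game is stopped, because V_{t_i} is v_i clipped to [P_{t_i}, R_{t_i}]. There
    are finitely many dates, so once l is small the survival product stays above
    1 - U up to the first such date and drops below 1 - U right after it, for any
    U strictly between 0 and 1. The randomised time is then equal to the optimal
    one, and not merely close to it ([randomised_time_near]).

    Convergence of the right limits. Between consecutive dates both values are
    martingales, so v_i^l - v_i is the conditional expectation given F_{t_i} of
    V^l - V at the next date ([right_limit_condexp]). At a date, the entropic
    step v |-> v + l Phi((P-v)/l) - l Phi((v-R)/l) is 1-Lipschitz and differs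
    from the clipping by at most sqrt l (2 + |P-v| + |v-R|)
    ([entropy_step_lip], [entropy_reflection_bound]). Evaluating the error at the
    unregularised right limits keeps it free of l apart from the factor sqrt l: by
    backward induction, for some integrable H,
      int_A |v_i^l - v_i| <= sqrt l int_A H   for every A in F_{t_i}
    ([right_limit_gap_bound]).

    From integrals to almost sure convergence. The inequality holds for all A in
    F_{t_i} and all l at once, so a maximal inequality of Doob type applies to
    any countable family of parameters: the event that |v_i^l - v_i| exceeds e
    for some l <= delta in the family has probability at most
    sqrt delta E[H] / e ([conditional_maximal_inequality]). Letting delta tend to
    0 gives almost sure convergence along every countable set of parameters
    ([countable_family_cvg0]). If the versions are continuous in l, the rational
    parameters suffice ([dense_within_cvg]). *)

(** * The entropy functions *)

Section entropy_functions.
Context {R : realType}.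
Implicit Types x y : R.

(** The mean of exp(u x) over u in [0,1]; it is the exponential of Phi. *)
Definition exp_slope x : R := if x == 0 then 1 else (expR x - 1) / x.

Lemma mul_exp_slope x : x * exp_slope x = expR x - 1.
Proof.
rewrite /exp_slope; case: eqVneq => [->|x0]; first by rewrite expR0 mul0r subrr.
by rewrite mulrC divfK.
Qed.

Lemma exp_slope_gt0 x : 0 < exp_slope x.
Proof.
have e := mul_exp_slope x; case: (ltrgtP x 0) => [x0|x0|->].
- have : expR x < 1 by rewrite -expR0 ltr_expR.
  by nra.
- have : 1 < expR x by rewrite -expR0 ltr_expR.
  by nra.
- by rewrite /exp_slope eqxx.
Qed.

Lemma expRN_mul x : expR (- x) * expR x = 1.
Proof. by rewrite -expRD addNr expR0. Qed.

Lemma exp_slope_opp x : exp_slope x = expR x * exp_slope (- x).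
Proof.
have [->|x0] := eqVneq x 0; first by rewrite oppr0 expR0 mul1r.
apply: (mulfI x0); rewrite mul_exp_slope mulrCA -[x * _]opprK -mulNr.
by rewrite mul_exp_slope mulrN mulrBr mulr1 mulrC expRN_mul opprB.
Qed.

Lemma exp_slope_ge1 x : 0 <= x -> 1 <= exp_slope x.
Proof.
rewrite le_eqVlt => /predU1P[<-|x0]; first by rewrite /exp_slope eqxx.
by rewrite -(ler_pM2l x0) mul_exp_slope mulr1; have := expR_ge1Dx x; lra.
Qed.

Lemma exp_slope_le1 x : x <= 0 -> exp_slope x <= 1.
Proof.
rewrite le_eqVlt => /predU1P[->|x0]; first by rewrite /exp_slope eqxx.
by rewrite -(ler_nM2l x0) mul_exp_slope mulr1; have := expR_ge1Dx x; lra.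
Qed.

(** Chord slopes of the exponential based at 0 increase, by convexity. Cleared of
    denominators, the claim is x (e^y - 1) >= y (e^x - 1) when x <= y have the
    same sign; it follows from the tangent lines 1 + z <= e^z at z = y - x and
    z = - x, or with x and y exchanged in the negative case. *)
Lemma exp_slope_nd x y : x <= y -> exp_slope x <= exp_slope y.
Proof.
move=> xy; case: (lerP x 0) => x0; last first.
  have y0 : 0 < y by exact: lt_le_trans xy.
  rewrite -(ler_pM2l (mulr_gt0 x0 y0)) mulrAC mul_exp_slope -mulrA mul_exp_slope.
  have h1 : expR x * (1 + (y - x)) <= expR y.
    by rewrite -[y in leRHS](subrKC x) expRD ler_pM2l ?expR_gt0// expR_ge1Dx.
  have h2 : (1 - x) * expR x <= 1.
    by rewrite -[leRHS](expRN_mul x) ler_pM2r ?expR_gt0//; exact: expR_ge1Dx.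
  have := @ler_wpM2l _ x (ltW x0) _ _ h1; have : 0 <= y - x by lra.
  by move=> /ler_wpM2l /(_ _ _ h2); lra.
case: (lerP 0 y) => y0.
  exact: le_trans (exp_slope_le1 x0) (exp_slope_ge1 y0).
have {}x0 : x < 0 by exact: le_lt_trans y0.
have xy0 : 0 < x * y by rewrite nmulr_rgt0.
rewrite -(ler_pM2l xy0) mulrAC mul_exp_slope -mulrA mul_exp_slope.
have h1 : expR y * (1 + (x - y)) <= expR x.
  by rewrite -[x in leRHS](subrKC y) expRD ler_pM2l ?expR_gt0// expR_ge1Dx.
have h2 : (1 - y) * expR y <= 1.
  by rewrite -[leRHS](expRN_mul y) ler_pM2r ?expR_gt0//; exact: expR_ge1Dx.
have := @ler_wnM2l _ y (ltW y0) _ _ h1; have : 0 <= y - x by lra.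
by move=> /ler_wpM2l /(_ _ _ h2); lra.
Qed.

Lemma PhiE x : Phi x = ln (exp_slope x).
Proof.
rewrite /Phi /Psi /exp_slope; case: eqVneq => [->|x0]; first by rewrite mul0r ln1.
by rewrite mulrA mulfV// mul1r.
Qed.

Lemma PhiN x : Phi (- x) = Phi x - x.
Proof.
rewrite !PhiE [in RHS]exp_slope_opp lnM ?posrE ?expR_gt0 ?exp_slope_gt0//.
by rewrite expRK addrAC subrr add0r.
Qed.

Lemma Phi_nd x y : x <= y -> Phi x <= Phi y.
Proof.
by move=> xy; rewrite !PhiE ler_ln ?posrE ?exp_slope_gt0 ?exp_slope_nd.
Qed.

(** The reflection formula [PhiN] turns monotonicity of Phi at the opposite
    points into the Lipschitz bound. *)
Lemma Phi_1lip x y : x <= y -> Phi y - Phi x <= y - x.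
Proof.
move=> xy; have := @Phi_nd (- y) (- x); rewrite lerN2 => /(_ xy).
by rewrite !PhiN; lra.
Qed.

Lemma ln1D_le_sqrt x : 0 <= x -> ln (1 + x) <= 2 * Num.sqrt x.
Proof.
move=> x0; have s0 := sqrtr_ge0 x.
have e : x = Num.sqrt x ^+ 2 by rewrite sqr_sqrtr.
rewrite (@le_trans _ _ (ln ((1 + Num.sqrt x) ^+ 2)))//.
  rewrite ler_ln ?posrE; [|lra|by rewrite exprn_gt0//; lra].
  by rewrite {1}e; nra.
rewrite lnXn; last by lra.
have := @le_ln1Dx _ (Num.sqrt x); rewrite mulr2n => /(_ ltac:(lra)); lra.
Qed.

(** Since exp_slope x >= 1 for x >= 0, also (1 + x) exp_slope x =
    exp_slope x + e^x - 1 >= e^x, so Phi x is at least x - ln (1 + x). The weaker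
    bound by a square root is kept because it scales: l sqrt(y / l) = sqrt l sqrt y. *)
Lemma Phi_pos_bound x : 0 <= x -> x - 2 * Num.sqrt x <= Phi x <= x.
Proof.
move=> x0; apply/andP; split; last first.
  rewrite -subr_le0 -PhiN PhiE -ln1.
  rewrite ler_ln ?posrE ?exp_slope_gt0//.
  by apply: exp_slope_le1; lra.
have h : expR x / (1 + x) <= exp_slope x.
  rewrite ler_pdivrMr; last by lra.
  by have := mul_exp_slope x; have := exp_slope_ge1 x0; lra.
have x1 : 0 < 1 + x by lra.
have := ln1D_le_sqrt x0.
move: h; rewrite -ler_ln ?posrE ?exp_slope_gt0 ?divr_gt0 ?expR_gt0//.
by rewrite -PhiE ln_div ?posrE ?expR_gt0// expRK; lra.
Qed.

Lemma Phi_bound x : Num.max x 0 - 2 * Num.sqrt `|x| <= Phi x <= Num.max x 0.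
Proof.
case: (lerP 0 x) => x0; first by rewrite ger0_norm// Phi_pos_bound.
rewrite ltr0_norm//; have := @Phi_pos_bound (- x).
by rewrite PhiN; lra.
Qed.

Lemma Psi_bound x : 0 <= Psi x <= 1.
Proof.
have [->|x0] := eqVneq x 0; first by rewrite /Psi eqxx; lra.
have : Phi x = x * Psi x by [].
have := Phi_nd (_ : 0 <= x); have := Phi_nd (_ : x <= 0).
have := Phi_1lip (_ : 0 <= x); have := Phi_1lip (_ : x <= 0).
have -> : Phi (0 : R) = 0 by rewrite /Phi mul0r.
move=> h1 h2 h3 h4 e; case: (ltrgtP x 0) x0 => // x0 _.
  have := h1 (ltW x0); have := h3 (ltW x0); rewrite e => k1 k2.
  by apply/andP; split; nra.
have := h2 (ltW x0); have := h4 (ltW x0); rewrite e => k1 k2.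
by apply/andP; split; nra.
Qed.

Lemma PsiN x : Psi (- x) = 1 - Psi x.
Proof.
have [->|x0] := eqVneq x 0; first by rewrite oppr0 /Psi eqxx; lra.
by apply: (mulfI x0); have := PhiN x; rewrite /Phi; lra.
Qed.

Lemma Psi_cvg_pinfty : Psi x @[x --> +oo] --> (1 : R).
Proof.
apply/cvgrPdist_le => e e0; near=> x.
have x0 : 0 < x by near: x; exact: nbhs_pinfty_gt.
have xe : (2 / e) ^+ 2 <= x by near: x; apply: nbhs_pinfty_ge; rewrite num_real.
have /andP[_ P1] := Psi_bound x.
have /andP[+ _] := Phi_pos_bound (ltW x0).
have zx : x = Num.sqrt x ^+ 2 by rewrite sqr_sqrtr// ltW.
have z0 : 0 < Num.sqrt x by rewrite sqrtr_gt0.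
have ze : 2 / e <= Num.sqrt x.
  by rewrite -(@ler_pXn2r _ 2)// ?nnegrE -?zx// ?divr_ge0 ?ltW.
rewrite ger0_norm ?subr_ge0// /Phi => h.
have h' : Num.sqrt x - 2 <= Num.sqrt x * Psi x.
  rewrite -(ler_pM2l z0) mulrA -expr2 -zx.
  by move: h zx; rewrite expr2; lra.
move: ze; rewrite ler_pdivrMr// => ze.
by rewrite -(ler_pM2l z0); lra.
Unshelve. all: by end_near. Qed.

Lemma Psi_cvg_ninfty : Psi x @[x --> -oo] --> (0 : R).
Proof.
have -> : Psi = fun x : R => 1 - Psi (- x).
  by apply/funext => x; rewrite PsiN; lra.
rewrite -[X in _ --> X](subrr 1); apply: cvgB; first exact: cvg_cst.
have := Psi_cvg_pinfty; apply: cvg_comp.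
exact/cvgNry.
Qed.

(** The two entropic corrections have slopes in [-1, 0] in v, since Phi has slope
    in [0, 1]; together with the identity the total slope lies in [-1, 1]. *)
Lemma entropy_step_lip (l p r v v' : R) : 0 < l ->
  `|(v' + entropy_reflection l p r v') - (v + entropy_reflection l p r v)|
    <= `|v' - v|.
Proof.
move=> l0; wlog vv' : v v' / v <= v'.
  move=> H; case: (leP v v') => [/H//|/ltW/H].
  by rewrite distrC (distrC v).
have iv : forall a b, l^-1 * a - l^-1 * b = l^-1 * (a - b) by move=> *; ring.
have mon a b : a <= b -> 0 <= l * Phi (l^-1 * b) - l * Phi (l^-1 * a) <= b - a.
  move=> ab; have ab' : l^-1 * a <= l^-1 * b by rewrite ler_pM2l ?invr_gt0.
  rewrite -mulrBr; apply/andP; split.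
    by rewrite mulr_ge0 ?(ltW l0)// subr_ge0 Phi_nd.
  have := Phi_1lip ab'; rewrite iv -(ler_pM2l l0) mulrA divff ?mul1r//.
  by rewrite gt_eqF.
have := mon (p - v') (p - v); have := mon (v - r) (v' - r).
rewrite /entropy_reflection !lerD2r lerD2l lerN2 => /(_ vv') h1 /(_ vv') h2.
by rewrite (ger0_norm (_ : 0 <= v' - v)) ?subr_ge0// ler_norml; lra.
Qed.

Lemma scaled_Phi_bound (l y : R) : 0 < l ->
  `|l * Phi (l^-1 * y) - Num.max y 0| <= Num.sqrt l * (1 + `|y|).
Proof.
move=> l0; have li : 0 < l^-1 by rewrite invr_gt0.
have := Phi_bound (l^-1 * y).
have -> : Num.max (l^-1 * y) 0 = l^-1 * Num.max y 0.
  by rewrite maxr_pMr ?mulr0// ltW.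
rewrite normrM (gtr0_norm li) sqrtrM ?(ltW li)// sqrtrV ?(ltW l0)//.
have s0 : 0 < Num.sqrt l by rewrite sqrtr_gt0.
have el : Num.sqrt l * Num.sqrt l = l by rewrite -expr2 sqr_sqrtr// ltW.
have ll : l * l^-1 = 1 by rewrite divff// gt_eqF.
have lls : l * (Num.sqrt l)^-1 = Num.sqrt l.
  by rewrite -{1}el mulfK// gt_eqF.
have ys : Num.sqrt `|y| * Num.sqrt `|y| = `|y| by rewrite -expr2 sqr_sqrtr.
move: (Num.sqrt `|y|) ys => z ys.
move=> /andP[h1 h2]; move: h1 h2; rewrite -(ler_pM2l l0) => h1.
rewrite -(ler_pM2l l0); move: h1; rewrite mulrBr !mulrA ll mul1r.
rewrite (mulrC l 2) -(mulrA 2 l) lls => h1 h2.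
(* The factor 1 + |y| absorbs 2 sqrt |y|, by (sqrt |y| - 1)^2 >= 0. *)
rewrite ler_norml; apply/andP; split; have := sqr_ge0 (z - 1); nra.
Qed.

Lemma entropy_reflection_bound (l p r v : R) : 0 < l ->
  `|entropy_reflection l p r v - reflection p r v|
    <= Num.sqrt l * (2 + `|p - v| + `|v - r|).
Proof.
move=> l0; have := scaled_Phi_bound (p - v) l0.
have := scaled_Phi_bound (v - r) l0; rewrite /entropy_reflection /reflection.
move=> h1 h2; rewrite !ler_norml in h1 h2 *; lra.
Qed.

Lemma entropy_reflection_le (l p r v : R) : 0 < l ->
  `|entropy_reflection l p r v| <= `|p - v| + `|v - r|.
Proof.
move=> l0; have h y : `|l * Phi (l^-1 * y)| <= `|y|.
  rewrite normrM gtr0_norm// -ler_pdivlMl//.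
  have -> : l^-1 * `|y| = `|l^-1 * y| by rewrite normrM gtr0_norm ?invr_gt0.
  have := Psi_bound (l^-1 * y); rewrite /Phi normrM => /andP[h0 h1].
  by rewrite (ger0_norm h0) ler_piMr.
by rewrite /entropy_reflection (le_trans (ler_normB _ _))// lerD.
Qed.

Lemma reflection_le (p r v : R) :
  `|reflection p r v| <= `|p - v| + `|v - r|.
Proof.
have h (y : R) : `|Num.max y 0| <= `|y|.
  by case: (leP 0 y) => y0; rewrite ?normr0.
by rewrite /reflection (le_trans (ler_normB _ _))// lerD.
Qed.

End entropy_functions.

(** * Randomised stopping times with degenerating jumps *)

Lemma ler_prod_subset {R : realType} (I : finType) (A B : pred I) (x : I -> R) :
  {subset A <= B} -> (forall i, 0 <= x i <= 1) ->
  \prod_(i | B i) x i <= \prod_(i | A i) x i.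
Proof.
move=> AB x01; rewrite big_mkcond [leRHS]big_mkcond; apply: ler_prod => i _.
have /andP[x0 x1] := x01 i; case: ifPn => [Bi|nBi].
  by rewrite x0/=; case: ifP.
rewrite ler01/= ifF//; apply/negP => Ai.
by have := AB i Ai; rewrite unfold_in (negPf nBi).
Qed.

Lemma cvg_survival_prod {R : realType} (N : nat) (G : set_system R)
    (dG : R -> 'I_N.+1 -> R) (h : 'I_N.+1 -> R) (A : pred 'I_N.+1) : Filter G ->
  (forall i, dG l i @[l --> G] --> h i) ->
  \prod_(i < N.+1 | A i) (1 - dG l i) @[l --> G] -->
    \prod_(i < N.+1 | A i) (1 - h i).
Proof.
move=> FG Gh; under eq_fun do rewrite big_mkcond; rewrite big_mkcond.
apply: cvg_big => [|i _].
  exact: mul_continuous.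
by case: ifP => _; [apply: cvgB; [exact: cvg_cst|exact: Gh]|exact: cvg_cst].
Qed.

Lemma scaled_cvg_pinfty {R : realType} (G : set_system R) (f : R -> R) (a : R) : Filter G ->
  G --> 0^'+ -> f l @[l --> G] --> a -> 0 < a -> l^-1 * f l @[l --> G] --> +oo.
Proof.
move=> FG G0 fa a0; apply/cvgryPge => A.
have m0 : 0 < Num.max A 0 + 1 by rewrite ltr_wpDl// le_max lexx orbT.
near=> l.
have l0 : 0 < l by near: l; apply: G0; exact: nbhs_right_gt.
have fl : a / 2 < f l by near: l; apply: (cvgr_gt _ fa); lra.
have lA : l * Num.max A 0 < a / 2.
  rewrite (@le_lt_trans _ _ (l * (Num.max A 0 + 1)))//; first by rewrite ler_pM2l// lerDl.
  rewrite -ltr_pdivlMr//; near: l; apply: G0; apply: nbhs_right_lt.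
  by rewrite !divr_gt0.
rewrite (@le_trans _ _ (Num.max A 0))// ?le_max ?lexx//.
by rewrite mulrC ler_pdivlMr// mulrC; lra.
Unshelve. all: by end_near. Qed.

Lemma Psi_scaled_cvg {R : realType} (G : set_system R) (f : R -> R) (a : R) : Filter G ->
  G --> 0^'+ -> f l @[l --> G] --> a -> a != 0 ->
  Psi (l^-1 * f l) @[l --> G] --> ((0 < a)%R%:R : R).
Proof.
move=> FG G0 fa; case: ltrgt0P => // a0 _.
  apply: (cvg_comp (fun l => l^-1 * f l) Psi) Psi_cvg_pinfty.
  exact: scaled_cvg_pinfty fa a0.
apply: (cvg_comp (fun l => l^-1 * f l) Psi) Psi_cvg_ninfty; apply/cvgNry.
rewrite [X in X @ G --> _](_ : _ = fun l => l^-1 * - f l); last first.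
  by apply/funext => l /=; rewrite mulrN.
apply: (@scaled_cvg_pinfty _ _ (fun l => - f l) (- a) FG G0).
  exact: cvgN.
by rewrite oppr_gt0.
Qed.

Section stopping.
Context {R : realType} {d : measure_display} {Omega : measurableType d}.
Variables (T : R) (N : nat) (ts : 'I_N.+1 -> R).
Hypothesis ts_incr : forall i j : 'I_N.+1, (i < j)%N -> ts i < ts j.
Hypothesis ts_max_lt : ts ord_max < T.

Lemma ts_le (i j : 'I_N.+1) : (i <= j)%N -> ts i <= ts j.
Proof.
by rewrite leq_eqVlt => /predU1P[/val_inj->//|/ts_incr/ltW].
Qed.

Lemma ts_ltT i : ts i < T.
Proof. by apply: le_lt_trans ts_max_lt; apply: ts_le; rewrite -ltnS. Qed.

(** The survival product tends to 1 up to the first date of [hit] after t, and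
    has a factor tending to 0 beyond it; the uniform variable lies strictly between
    the two limits. The jump at ts k enters the product only for s > ts k, so the
    set of s defining the randomised time is eventually the open half-line beyond
    ts k, whose infimum is ts k. Without such a date the set is eventually empty and
    the truncation at T decides. *)
Lemma randomised_time_near (G : set_system R) (dG : R -> 'I_N.+1 -> Omega -> R)
    (hit : pred 'I_N.+1) (U : Omega -> R) (t : R) (w : Omega) (Q : R -> Prop) :
  Filter G -> t <= T ->
  (forall l i, 0 <= dG l i w <= 1) ->
  (forall i, dG l i w @[l --> G] --> ((hit i)%:R : R)) ->
  0 < U w < 1 ->
  (forall i, Q (ts i) <-> hit i) -> Q T ->
  \forall l \near G, randomised_time T ts (dG l) U t w =
    ereal_inf [set s%:E | s in [set s | exercise_dates T ts s /\ t <= s /\ Q s]].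
Proof.
move=> FG tT dG01 dGh /andP[U0 U1] Qhit QT.
have dG01' l i : 0 <= 1 - dG l i w <= 1 by have := dG01 l i; lra.
have [[k0 /andP[tk0 hk0]]|nohit] := pselect (exists k, (t <= ts k) && hit k).
  case: (@arg_minnP _ k0 (fun k => (t <= ts k) && hit k) (fun k => k : nat)).
    by rewrite tk0.
  move=> k /andP[tk hk] kmin {k0 tk0 hk0}.
  have -> : ereal_inf [set s%:E | s in
      [set s | exercise_dates T ts s /\ t <= s /\ Q s]] = (ts k)%:E.
    apply/eqP; rewrite eq_le; apply/andP; split.
      apply: ereal_inf_lbound; exists (ts k) => //.
      by split; [left; exists k|split=> //; apply/Qhit].
    apply: le_ereal_inf_tmp => _ [s [[[i _ <-]|->] [ts_ Qs]] <-]; rewrite lee_fin.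
      by apply: ts_le; apply: kmin; rewrite ts_; apply/Qhit.
    by apply: ltW; exact: ts_ltT.
  have alive : \forall l \near G,
      1 - U w < \prod_(i < N.+1 | t <= ts i < ts k) (1 - dG l i w).
    apply: cvgr_gt; first exact: (@cvg_survival_prod _ _ _ _ (fun i => (hit i)%:R)).
    rewrite big1 ?gtrBl// => i /andP[ti ik]; suff -> : hit i = false by rewrite subr0.
    apply/negP => hi; have /ts_le := kmin i (introT andP (conj ti hi)).
    by rewrite leNgt ik.
  have dead : \forall l \near G, 1 - dG l k w < 1 - U w.
    apply: cvgr_lt; first by apply: cvgB; [exact: cvg_cst|exact: dGh].
    by rewrite hk subrr subr_gt0.
  near=> l.
  have al : 1 - U w < \prod_(i < N.+1 | t <= ts i < ts k) (1 - dG l i w) by near: l.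
  have de : 1 - dG l k w < 1 - U w by near: l.
  rewrite /randomised_time /survival.
  have -> : [set s | t <= s /\
      U w <= 1 - \prod_(i < N.+1 | t <= ts i < s) (1 - dG l i w)] =
      [set s | ts k < s].
    apply/seteqP; split => s /=.
      move=> [ts_ Us]; rewrite ltNge; apply/negP => sk; move: al; apply/negP.
      rewrite -leNgt.
      rewrite (le_trans (y := \prod_(i < N.+1 | t <= ts i < s) (1 - dG l i w)))//;
        last lra.
      apply: ler_prod_subset => // i; rewrite !unfold_in => /andP[-> /=].
      by move=> /lt_le_trans; apply.
    move=> ks; split; first exact: le_trans (ltW ks).
    have : \prod_(i < N.+1 | t <= ts i < s) (1 - dG l i w) <=
        \prod_(i < N.+1 | i == k) (1 - dG l i w).
      by apply: ler_prod_subset => // i; rewrite !unfold_in => /eqP ->; rewrite tk.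
    by rewrite big_pred1_eq; lra.
  have -> : ereal_inf [set s%:E | s in [set s | ts k < s]] = (ts k)%:E.
    apply/eqP; rewrite eq_le; apply/andP; split.
      apply/lee_addgt0Pr => e e0; apply: ereal_inf_lbound.
      by exists (ts k + e); rewrite ?EFinD//= ltrDl.
    by apply: le_ereal_inf_tmp => _ [s ks <-]; rewrite lee_fin ltW.
  by apply: min_idPl; rewrite lee_fin ltW// ts_ltT.
have -> : ereal_inf [set s%:E | s in
    [set s | exercise_dates T ts s /\ t <= s /\ Q s]] = T%:E.
  apply/eqP; rewrite eq_le; apply/andP; split.
    by apply: ereal_inf_lbound; exists T => //; split; [right|split].
  apply: le_ereal_inf_tmp => _ [s [[[i _ <-]|->] [ts_ Qs]] <-] //.
  by case: nohit; exists i; rewrite ts_; apply/Qhit.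
have alive : \forall l \near G,
    1 - U w < \prod_(i < N.+1 | t <= ts i) (1 - dG l i w).
  apply: cvgr_gt; first exact: (@cvg_survival_prod _ _ _ _ (fun i => (hit i)%:R)).
  rewrite big1 ?gtrBl// => i ti; suff -> : hit i = false by rewrite subr0.
  by apply/negP => hi; apply: nohit; exists i; rewrite ti.
near=> l.
have al : 1 - U w < \prod_(i < N.+1 | t <= ts i) (1 - dG l i w) by near: l.
rewrite /randomised_time /survival.
have -> : [set s | t <= s /\
    U w <= 1 - \prod_(i < N.+1 | t <= ts i < s) (1 - dG l i w)] = set0.
  apply/seteqP; split => s //= [ts_ Us]; move: al; apply/negP.
  rewrite -leNgt.
  rewrite (le_trans (y := \prod_(i < N.+1 | t <= ts i < s) (1 - dG l i w)))//;
    last lra.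
  by apply: ler_prod_subset => // i; rewrite !unfold_in => /andP[].
by rewrite image_set0 ereal_inf0; apply: min_idPr; rewrite leey.
Unshelve. all: by end_near. Qed.

End stopping.

Section pathwise_convergence.
Context {R : realType} {d : measure_display} {Omega : measurableType d}.
Variables (T : R) (N : nat) (ts : 'I_N.+1 -> R).
Hypothesis ts_incr : forall i j : 'I_N.+1, (i < j)%N -> ts i < ts j.
Hypothesis ts_max_lt : ts ord_max < T.
Variables (payP payR V : R -> Omega -> R) (Vl : R -> R -> Omega -> R).
Variables (U : Omega -> R) (t : R) (w : Omega) (G : set_system R).
Hypothesis FG : Filter G.
Hypothesis tT : t <= T.
Hypothesis G0 : G --> 0^'+.
Hypothesis U01 : 0 < U w < 1.
Hypothesis PR : forall i, payP (ts i) w < payR (ts i) w.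
Hypothesis VE : forall i, V (ts i) w = right_limit V (ts i) w +
  reflection (payP (ts i) w) (payR (ts i) w) (right_limit V (ts i) w).
Hypothesis VT : V T w = payP T w.
Hypothesis Vl_cvg : forall i,
  right_limit (Vl l) (ts i) w @[l --> G] --> right_limit V (ts i) w.

(** The buyer stops at t_i when the value V there, which is v_i clipped to [P, R],
    sits at its floor P. As v_i differs from P and P < R, this means v_i < P. *)
Lemma entropy_buyer_near :
  (forall i, right_limit V (ts i) w != payP (ts i) w) ->
  \forall l \near G, entropy_buyer T ts payP l (Vl l) U t w =
    optimal_buyer T ts payP V t w.
Proof.
move=> vp; apply: (randomised_time_near ts_incr ts_max_lt
  (dG := fun l => dGammaP ts payP l (Vl l))
  (hit := fun i => 0 < payP (ts i) w - right_limit V (ts i) w)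
  (Q := fun s => V s w = payP s w)) => //.
- by move=> l i; exact: Psi_bound.
- move=> i; apply: Psi_scaled_cvg => //; first by apply: cvgB; [exact: cvg_cst|exact: Vl_cvg].
  by rewrite subr_eq0 eq_sym.
- move=> i; have := vp i; have := PR i; rewrite VE /reflection.
  move: (payP _ _) (payR _ _) (right_limit _ _ _) => p r v pr /eqP vp'.
  rewrite subr_gt0; split.
    by case: (leP (p - v) 0); case: (leP (v - r) 0); lra.
  by move=> vltp; case: (leP (p - v) 0); case: (leP (v - r) 0); lra.
Qed.

(** Mirror image of [entropy_buyer_near], with the ceiling R; equality of the two
    payoffs at T is what makes T a stopping date of the seller too. *)
Lemma entropy_seller_near : payR T w = payP T w ->
  (forall i, right_limit V (ts i) w != payR (ts i) w) ->
  \forall l \near G, entropy_seller T ts payR l (Vl l) U t w =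
    optimal_seller T ts payR V t w.
Proof.
move=> RT vr; apply: (randomised_time_near ts_incr ts_max_lt
  (dG := fun l => dGammaR ts payR l (Vl l))
  (hit := fun i => 0 < right_limit V (ts i) w - payR (ts i) w)
  (Q := fun s => V s w = payR s w)) => //; last by rewrite VT.
- by move=> l i; exact: Psi_bound.
- move=> i; apply: Psi_scaled_cvg => //; first by apply: cvgB; [exact: Vl_cvg|exact: cvg_cst].
  by rewrite subr_eq0.
- move=> i; have := vr i; have := PR i; rewrite VE /reflection.
  move: (payP _ _) (payR _ _) (right_limit _ _ _) => p r v pr /eqP vr'.
  rewrite subr_gt0; split.
    by case: (leP (p - v) 0); case: (leP (v - r) 0); lra.
  by move=> vltp; case: (leP (p - v) 0); case: (leP (v - r) 0); lra.
Qed.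

End pathwise_convergence.

(** * Domination of families of conditional expectations *)

Section conditional_expectations.
Context {R : realType} {d : measure_display} {Omega : measurableType d}.
Variable Pr : probability Omega R.
Variable G : set_system Omega.
Hypothesis sG : sigma_algebra setT G.
Hypothesis GM : G `<=` measurable.
Implicit Types Y Z H : Omega -> R.

Lemma sub_measurableE :
  (measurable : set_system (g_sigma_algebraType G)) = G.
Proof. exact: sigma_algebra_id. Qed.

Lemma measurable_wrtP Y : measurable_wrt G Y <->
  forall B, measurable B -> G (Y @^-1` B).
Proof.
split=> [mY B mB|mY _ B mB].
  have := mY measurableT B mB; rewrite setTI.
  by rewrite -[X in _ -> X _]sub_measurableE.
by rewrite setTI sub_measurableE; exact: mY.
Qed.

Lemma measurable_wrt_measurable Y : measurable_wrt G Y -> measurable_fun setT Y.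
Proof. by move=> /measurable_wrtP mY _ B mB; rewrite setTI; exact/GM/mY. Qed.

Lemma integral_condexp_diff Z Z' Y Y' (A : set Omega) :
  Pr.-integrable setT (EFin \o Z) -> Pr.-integrable setT (EFin \o Z') ->
  is_condexp Pr G Z Y -> is_condexp Pr G Z' Y' -> G A ->
  (\int[Pr]_(w in A) (Y' w - Y w)%:E = \int[Pr]_(w in A) (Z' w - Z w)%:E)%E.
Proof.
move=> iZ iZ' [_ iY eY] [_ iY' eY'] GA; have mA := GM GA.
have restr X : Pr.-integrable setT (EFin \o X) -> Pr.-integrable A (EFin \o X).
  by apply: integrableS.
transitivity (\int[Pr]_(w in A) ((Y' w)%:E - (Y w)%:E))%E => //.
transitivity (\int[Pr]_(w in A) ((Z' w)%:E - (Z w)%:E))%E => //.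
rewrite !integralB_EFin ?eY ?eY'//; exact: restr.
Qed.

(** Where Y <= Y' the modulus can be dropped on the left, and conditional
    expectations have the same integral over A as the original variables. *)
Lemma condexp_norm_le_ordered Z Z' Y Y' (A : set Omega) :
  Pr.-integrable setT (EFin \o Z) -> Pr.-integrable setT (EFin \o Z') ->
  is_condexp Pr G Z Y -> is_condexp Pr G Z' Y' -> G A ->
  (forall w, A w -> Y w <= Y' w) ->
  (\int[Pr]_(w in A) `|Y' w - Y w|%:E <= \int[Pr]_(w in A) `|Z' w - Z w|%:E)%E.
Proof.
move=> iZ iZ' cY cY' GA YY'; have mA := GM GA.
have iDZ : Pr.-integrable setT (EFin \o (fun w => Z' w - Z w)).
  by have := integrableB measurableT iZ' iZ.
rewrite (eq_integral (fun w => (Y' w - Y w)%:E)); last first.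
  by move=> w; rewrite inE => /YY' h; rewrite ger0_norm// subr_ge0.
rewrite (integral_condexp_diff iZ iZ' cY cY')//; apply: le_integral => //.
- exact: integrableS iDZ.
- by apply: integrableS (integrable_norm iDZ).
- by move=> w _; rewrite lee_fin ler_norm.
Qed.

(** Conditional expectation contracts the L1 distance over every event of G:
    split the event according to the sign of Y' - Y, which is G-measurable. *)
Lemma condexp_norm_le Z Z' Y Y' (A : set Omega) :
  Pr.-integrable setT (EFin \o Z) -> Pr.-integrable setT (EFin \o Z') ->
  is_condexp Pr G Z Y -> is_condexp Pr G Z' Y' -> G A ->
  (\int[Pr]_(w in A) `|Y' w - Y w|%:E <= \int[Pr]_(w in A) `|Z' w - Z w|%:E)%E.
Proof.
move=> iZ iZ' cY cY' GA.
have [mY iY _] := cY; have [mY' iY' _] := cY'.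
have GB : G (A `&` [set w | Y w <= Y' w]).
  rewrite -sub_measurableE; apply: measurableI; first by rewrite sub_measurableE.
  rewrite -[X in measurable X]setTI; have := measurable_fun_ler mY mY'.
  by move=> /(_ measurableT [set true] I).
have GC : G (A `&` [set w | Y' w < Y w]).
  rewrite -sub_measurableE; apply: measurableI; first by rewrite sub_measurableE.
  rewrite -[X in measurable X]setTI; have := measurable_fun_ltr mY' mY.
  by move=> /(_ measurableT [set true] I).
have eA : A = (A `&` [set w | Y w <= Y' w]) `|` (A `&` [set w | Y' w < Y w]).
  rewrite -setIUr -[LHS]setIT; congr (_ `&` _); apply/seteqP; split=> // w _ /=.
  by case: (leP (Y w) (Y' w)) => ?; [left|right].
have dBC : [disjoint A `&` [set w | Y w <= Y' w] & A `&` [set w | Y' w < Y w]].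
  apply/disj_setPRL => w /= [_ h] [_]; by rewrite leNgt h.
have mn (X X' : Omega -> R) (D : set Omega) :
    Pr.-integrable setT (EFin \o X) -> Pr.-integrable setT (EFin \o X') ->
    measurable_fun D (fun w => `|X' w - X w|%:E).
  move=> iX iX'; have := integrableB measurableT iX' iX.
  by move=> /(@integrable_norm _ _ _ _ _ (fun w => X' w - X w)) /measurable_int;
     exact: measurable_funTS.
rewrite eA !ge0_integral_setU//; try exact: mn; try exact: GM.
apply: leeD; first by apply: condexp_norm_le_ordered => // w [].
under eq_integral do rewrite distrC.
under [leRHS]eq_integral do rewrite distrC.
by apply: condexp_norm_le_ordered => // w [_ /ltW].
Qed.

(** Doob's argument: the event is cut into the G-measurable pieces on which k is
    the first index with |f k| > e. On each piece Markov's inequality for f k and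
    the domination hypothesis apply, and the pieces are disjoint. *)
Lemma conditional_maximal_inequality (f : nat -> Omega -> R) H (e : R) :
  0 < e -> (forall k, measurable_wrt G (f k)) ->
  measurable_fun setT H -> (forall w, 0 <= H w) ->
  (forall k A, G A ->
     (\int[Pr]_(w in A) `|f k w|%:E <= \int[Pr]_(w in A) (H w)%:E)%E) ->
  (e%:E * Pr (\bigcup_k [set w | (e < `|f k w|)%R]) <= \int[Pr]_w (H w)%:E)%E.
Proof.
move=> e0 mf mH H0 fH; set E := fun k => [set w | e < `|f k w|].
have GE k : G (E k).
  rewrite -sub_measurableE; have := measurableT_comp (@normr_measurable R setT) (mf k).
  move=> /(_ measurableT `]e, +oo[%classic (measurable_itv _)).
  rewrite setTI; congr (measurable _); apply/seteqP; split=> w /=;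
    by rewrite in_itv/= andbT.
have GDU k : G (seqDU E k).
  rewrite -sub_measurableE; apply: (@seqDU_measurable _ (g_sigma_algebraType G)) => i.
  by rewrite sub_measurableE.
rewrite seqDU_bigcup_eq measure_bigcup//; last by move=> k _; exact: GM.
rewrite (@le_trans _ _ (\int[Pr]_(w in \bigcup_k seqDU E k) (H w)%:E)%E)//; last first.
  apply: ge0_subset_integral => //.
  - by apply: bigcupT_measurable => k; exact: GM.
  - exact/measurable_EFinP.
  - by move=> w _; rewrite lee_fin.
rewrite ge0_integral_bigcup//; last first.
- by move=> w _; rewrite lee_fin.
- by apply: measurable_funTS; exact/measurable_EFinP.
- by move=> k; exact: GM.
rewrite (eq_eseriesl (Q := xpredT)); last by move=> i; rewrite in_setT.
rewrite -nneseriesZl//; apply: lee_nneseries => // k _.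
  by rewrite mule_ge0// lee_fin ltW.
apply: le_trans (fH k _ (GDU k)).
rewrite -integral_cst; last exact: GM.
apply: ge0_le_integral; [exact: GM|by move=> *; rewrite lee_fin ltW| | |].
- exact: measurable_cst.
- apply/measurable_EFinP/measurableT_comp => //; apply: measurable_funTS.
  exact: measurable_wrt_measurable.
- by move=> w [Ew _]; rewrite lee_fin ltW.
Qed.

Lemma countable_sub_range (L : set R) : countable L ->
  exists u : nat -> R, L `<=` range u.
Proof.
move=> /pfcard_geP[->|[u]]; first by exists (fun=> 0).
by exists u => x Lx; have [k _ <-] := surj (f := u) Lx; exists k.
Qed.

(** By [conditional_maximal_inequality] applied to the parameters of L below
    delta, the event that some |D l| with l <= delta in L exceeds 1/(m+1) has
    probability at most (m+1) sqrt delta E[H]. These events decrease with delta, so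
    their intersection is null for every m. *)
Lemma countable_family_cvg0 (L : set R) (D : R -> Omega -> R) H :
  countable L -> (forall l, 0 < l -> measurable_wrt G (D l)) ->
  Pr.-integrable setT (EFin \o H) -> (forall w, 0 <= H w) ->
  (forall l A, 0 < l -> G A ->
     (\int[Pr]_(w in A) `|D l w|%:E <=
      (Num.sqrt l)%:E * \int[Pr]_(w in A) (H w)%:E)%E) ->
  {ae Pr, forall w, D l w @[l --> within L 0^'+] --> (0 : R)}.
Proof.
move=> /countable_sub_range[u Lu] mD iH H0 DH.
have mH : measurable_fun setT H by apply/measurable_EFinP; exact: measurable_int iH.
pose delta n : R := n.+1%:R^-1.
have delta0 n : 0 < delta n by rewrite invr_gt0.
(* Parameters outside (0, delta n] are given the zero function, so that a single
   enumeration u of L serves for every n. *)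
pose f n k : Omega -> R := if 0 < u k <= delta n then D (u k) else cst 0.
have mf n k : measurable_wrt G (f n k).
  rewrite /f; case: ifP => [/andP[/mD]//|_].
  exact: (@measurable_cst _ _ (g_sigma_algebraType G)).
have fH n k A : G A -> (\int[Pr]_(w in A) `|f n k w|%:E <=
    \int[Pr]_(w in A) (Num.sqrt (delta n) * H w)%:E)%E.
  move=> GA; have mA := GM GA.
  rewrite /f; case: ifP => [/andP[u0 un]|_]; last first.
    rewrite (eq_integral (cst 0%E)); last by move=> w _; rewrite /= normr0.
    rewrite integral0.
    by apply: integral_ge0 => w _; rewrite lee_fin mulr_ge0.
  apply: le_trans (DH _ _ u0 GA) _.
  under [leRHS]eq_integral do rewrite EFinM.
  rewrite integralZl//; last exact: integrableS iH.
  apply: lee_wpmul2r; first by apply: integral_ge0 => w _; rewrite lee_fin.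
  by rewrite lee_fin ler_wsqrtr.
pose E m n := \bigcup_k [set w | (m.+1%:R^-1 < `|f n k w|)%R].
have mE m n : measurable (E m n).
  apply: bigcupT_measurable => k; rewrite -[X in measurable X]setTI.
  have := measurableT_comp (@normr_measurable R setT)
    (measurable_wrt_measurable (mf n k)).
  move=> /(_ measurableT `]m.+1%:R^-1, +oo[%classic (measurable_itv _)).
  congr (measurable _); rewrite !setTI; apply/seteqP; split=> w /=;
    by rewrite in_itv/= andbT.
have PE m n : (Pr (E m n) <=
    (m.+1%:R * Num.sqrt (delta n) * fine (\int[Pr]_w (H w)%:E))%:E)%E.
  have m0 : 0 < m.+1%:R^-1 :> R by rewrite invr_gt0.
  rewrite -mulrA EFinM -lee_pdivrMl// -[(_^-1)%:E]/(m.+1%:R^-1%:E).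
  apply: le_trans (conditional_maximal_inequality m0 (mf n) _ _ (fH n)) _.
  - exact: measurable_funM.
  - by move=> w; rewrite mulr_ge0.
  under eq_integral do rewrite EFinM.
  by rewrite integralZl// EFinM fineK//; apply: integrable_fin_num.
have NE m : Pr.-negligible (\bigcap_n E m n).
  have mI : measurable (\bigcap_n E m n) by exact: bigcapT_measurable.
  apply/negligibleP => //; apply/eqP; rewrite eq_le measure_ge0 andbT.
  apply/lee_addgt0Pr => e e0; rewrite add0e.
  set K := m.+1%:R * fine (\int[Pr]_w (H w)%:E).
  have K0 : 0 <= K by rewrite mulr_ge0// fine_ge0// integral_ge0// => w _; rewrite lee_fin.
  have [n nK] : exists n, delta n < (e / (K + 1)) ^+ 2.
    have : \forall n \near \oo, delta n < (e / (K + 1)) ^+ 2.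
      apply: (near_infty_natSinv_lt (PosNum _)).
      by rewrite exprn_gt0// divr_gt0// ltr_wpDl.
    by move=> /filter_ex[n]; exists n.
  apply: (@le_trans _ _ (Pr (E m n))).
    by apply: le_measure; rewrite ?inE//; apply: bigcap_inf.
  apply: le_trans (PE m n) _; rewrite lee_fin mulrAC -/K.
  have sK : Num.sqrt (delta n) <= e / (K + 1).
    rewrite -(ger0_norm (_ : 0 <= e / (K + 1))); last by rewrite divr_ge0 ?ltW// ltr_wpDl.
    by rewrite -sqrtr_sqr ler_wsqrtr// ltW.
  have : K * Num.sqrt (delta n) <= (K + 1) * (e / (K + 1)).
    by apply: ler_pM => //; rewrite ?sqrtr_ge0// lerDl.
  by rewrite [(K + 1) * _]mulrC divfK// gt_eqF// ltr_wpDl.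
have : {ae Pr, forall w, forall m, ~ (\bigcap_n E m n) w}.
  apply: ae_foralln => m; apply: negligibleS (NE m).
  by move=> w /= /contrapT.
apply: filterS => w hw; apply/cvgrPdist_le => e e0.
have [m me] : exists m, m.+1%:R^-1 < e.
  have : \forall n \near \oo, n.+1%:R^-1 < e by exact: (near_infty_natSinv_lt (PosNum e0)).
  by move=> /filter_ex[n]; exists n.
have [n hn] : exists n, ~ E m n w.
  apply: contrapT => h; apply: (hw m) => n _; apply: contrapT => hn.
  by apply: h; exists n.
have near0 : \forall l \near 0^'+, 0 < l <= delta n.
  near=> l; apply/andP; split; near: l; first exact: nbhs_right_gt.
  exact: nbhs_right_le.
rewrite near_withinE; apply: filterS near0 => l ln /Lu[k _ uk].
have <- : f n k w = D l w by rewrite /f uk ln.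
rewrite sub0r normrN; apply: ltW; apply: le_lt_trans me.
by rewrite leNgt; apply/negP => h; apply: hn; exists k.
Unshelve. all: by end_near. Qed.

End conditional_expectations.

(** * Backward equations *)

Section filtrations.
Context {R : realType} {d : measure_display} {Omega : measurableType d}.
Variable Pr : probability Omega R.
Implicit Types X Y : Omega -> R.

Lemma integrable_ae_bound X Y : measurable_fun setT Y ->
  Pr.-integrable setT (EFin \o X) -> {ae Pr, forall w, `|Y w| <= X w} ->
  Pr.-integrable setT (EFin \o Y).
Proof.
move=> mY iX YX; apply/integrableP; split; first exact/measurable_EFinP.
have /integrableP[mX] := iX; apply: le_lt_trans.
apply: ae_ge0_le_integral => //.
- by apply: measurableT_comp => //; exact/measurable_EFinP.
- exact: measurableT_comp.
apply: filterS YX => w /= h _; rewrite lee_fin.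
exact: le_trans h (ler_norm _).
Qed.

Lemma integrable_normB X Y : Pr.-integrable setT (EFin \o X) ->
  Pr.-integrable setT (EFin \o Y) ->
  Pr.-integrable setT (EFin \o (fun w => `|X w - Y w|)).
Proof.
move=> iX iY; apply: (@integrable_norm _ _ _ _ _ (fun w => X w - Y w)).
by have := integrableB measurableT iX iY.
Qed.

Variable F : R -> set_system Omega.
Hypothesis hF : usual_filtration Pr F.

Lemma measurable_wrt_filtration s Y : 0 <= s -> measurable_wrt (F s) Y ->
  measurable_fun setT Y.
Proof.
move=> s0; apply: (measurable_wrt_measurable (G := F s)).
  exact: filtration_sigma_algebra hF _ s0.
exact: filtration_measurable hF _ s0.
Qed.

(** Completeness puts every subset of the exceptional null set into F s. *)
Lemma measurable_wrt_ae_eq s X Y : 0 <= s -> measurable_wrt (F s) X ->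
  {ae Pr, forall w, Y w = X w} -> measurable_wrt (F s) Y.
Proof.
move=> s0; have sF := filtration_sigma_algebra hF s0.
have null A : Pr.-negligible A -> F s A.
  by move=> /(filtration_complete hF); exact: (filtration_nondecreasing hF (lexx 0) s0).
move=> /(measurable_wrtP sF) mX YX; apply/(measurable_wrtP sF) => B mB.
have -> : Y @^-1` B = (X @^-1` B `\` [set w | X w <> Y w]) `|`
    (Y @^-1` B `&` [set w | X w <> Y w]).
  apply/seteqP; split=> w /=.
    move=> BY; have [XY|XY] := pselect (X w = Y w); last by right.
    by left; split; rewrite ?XY.
  by case=> [[BX /contrapT <-]|[]].
have nN : Pr.-negligible [set w | X w <> Y w].
  by apply: negligibleS YX => w /= + h; rewrite h.
rewrite -(sub_measurableE sF); apply: measurableU.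
  apply: measurableD; rewrite sub_measurableE//; first exact: mX.
  exact: null.
rewrite sub_measurableE//; apply: null; apply: negligibleS nN.
exact: subIsetr.
Qed.

(** This is right continuity of the filtration; monotonicity makes a right
    neighbourhood of s sufficient. *)
Lemma measurable_wrt_right s e X : 0 <= s -> s < e ->
  (forall u, s < u <= e -> measurable_wrt (F u) X) -> measurable_wrt (F s) X.
Proof.
move=> s0 se mX; have sF u : 0 <= u -> sigma_algebra setT (F u).
  exact: (filtration_sigma_algebra hF).
apply/(measurable_wrtP (sF _ s0)) => B mB.
apply: (filtration_right_continuous hF) => // u /= su.
have u0 : 0 <= Num.min u e by rewrite le_min; apply/andP; split; lra.
have : F (Num.min u e) (X @^-1` B).
  have [+ _] := measurable_wrtP (sF _ u0) X; apply=> //; apply: mX.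
  by rewrite lt_min su se ge_min lexx orbT.
by apply: (filtration_nondecreasing hF u0); rewrite ge_min lexx.
Qed.

End filtrations.

Section exercise_date_intervals.
Context {R : realType} {d : measure_display} {Omega : measurableType d}.
Variables (T : R) (N : nat) (ts : 'I_N.+1 -> R).
Hypothesis ts0 : ts ord0 = 0.
Hypothesis ts_incr : forall i j : 'I_N.+1, (i < j)%N -> ts i < ts j.
Hypothesis ts_max_lt : ts ord_max < T.

Definition next_date (i : 'I_N.+1) : R :=
  if (i < N)%N then ts (inord i.+1) else T.

Lemma ts_ge0 i : 0 <= ts i.
Proof. by rewrite -ts0; apply: (ts_le ts_incr). Qed.

Lemma ts_lt_next i : ts i < next_date i.
Proof.
rewrite /next_date; case: ifP => iN; last exact: ts_ltT.
by apply: ts_incr; rewrite inordK.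
Qed.

Lemma next_date_le i : next_date i <= T.
Proof.
by rewrite /next_date; case: ifP => iN //; apply: ltW; exact: ts_ltT.
Qed.

Lemma dates_after_next i s j : ts i < s <= next_date i ->
  (s <= ts j < T) = (i < j)%N.
Proof.
move=> /andP[is_ sn]; rewrite ts_ltT// andbT; apply/idP/idP => [sj|ij].
  rewrite ltnNge; apply/negP => /(ts_le ts_incr) ji.
  by have := lt_le_trans is_ (le_trans sj ji); rewrite ltxx.
have iN : (i < N)%N by apply: leq_trans ij _; rewrite -ltnS.
apply: le_trans sn _; rewrite /next_date iN; apply: ts_le => //.
by rewrite inordK.
Qed.

Lemma dates_from i j : (ts i <= ts j < T) = (i <= j)%N.
Proof.
rewrite ts_ltT// andbT; apply/idP/idP => [|/(ts_le ts_incr)//].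
by apply: contraTT; rewrite -ltnNge -ltNge => /ts_incr.
Qed.

Variables payP payR : R -> Omega -> R.

(** On (t_i, t_{i+1}] the sum in the equation runs over the dates after t_i, so
    V - M is constant there; right continuity of M identifies the right limit, and
    at t_i itself the sum has the additional term of index i. *)
Lemma right_limit_step (V M : R -> Omega -> R) (g : R -> R -> R -> R)
    (w : Omega) :
  cadlag T (M^~ w) ->
  (forall t, 0 <= t <= T ->
    V t w = payP T w - (M T w - M t w) +
      \sum_(i < N.+1 | t <= ts i < T)
         g (payP (ts i) w) (payR (ts i) w) (right_limit V (ts i) w)) ->
  forall i,
    (forall s, ts i < s <= next_date i ->
       right_limit V (ts i) w = V s w - (M s w - M (ts i) w)) /\
    V (ts i) w = right_limit V (ts i) w +
      g (payP (ts i) w) (payR (ts i) w) (right_limit V (ts i) w).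
Proof.
move=> [Mr _] VE i; have i0 := ts_ge0 i; have iT := ts_ltT ts_incr ts_max_lt i.
have nT := next_date_le i; have ni := ts_lt_next i.
pose c := payP T w - M T w + \sum_(j < N.+1 | (i < j)%N)
   g (payP (ts j) w) (payR (ts j) w) (right_limit V (ts j) w).
have VM s : ts i < s <= next_date i -> V s w = M s w + c.
  move=> h; rewrite VE; last by lra.
  rewrite (eq_bigl (fun j : 'I_N.+1 => (i < j)%N)) ?/c; first by lra.
  by move=> j; exact: dates_after_next.
have rlE : right_limit V (ts i) w = M (ts i) w + c.
  rewrite /right_limit; apply: cvg_lim => //.
  have : M s w + c @[s --> (ts i)^'+] --> M (ts i) w + c.
    by apply: cvgD; [apply: Mr; rewrite i0|exact: cvg_cst].
  apply: cvg_trans; apply: near_eq_cvg; near=> s.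
  rewrite VM//; apply/andP; split; near: s; first exact: nbhs_right_gt.
  exact: nbhs_right_le.
split=> [s /VM ->|]; first by rewrite rlE; lra.
rewrite VE; last by lra.
rewrite (bigD1 i) /=; last by rewrite lexx.
rewrite (eq_bigl (fun j : 'I_N.+1 => (i < j)%N)); first by rewrite rlE /c; lra.
by move=> j; rewrite dates_from ltn_neqAle eq_sym andbC.
Unshelve. all: by end_near. Qed.

End exercise_date_intervals.

Section backward_equations.
Context {R : realType} {d : measure_display} {Omega : measurableType d}.
Variable Pr : probability Omega R.
Implicit Types X : Omega -> R.
Variable F : R -> set_system Omega.
Hypothesis hF : usual_filtration Pr F.
Variables (T : R) (N : nat) (ts : 'I_N.+1 -> R).
Hypothesis ts0 : ts ord0 = 0.
Hypothesis ts_incr : forall i j : 'I_N.+1, (i < j)%N -> ts i < ts j.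
Hypothesis ts_max_lt : ts ord_max < T.
Variables payP payR : R -> Omega -> R.
Hypothesis iP : forall i, Pr.-integrable setT (EFin \o payP (ts i)).
Hypothesis iR : forall i, Pr.-integrable setT (EFin \o payR (ts i)).
Hypothesis iPT : Pr.-integrable setT (EFin \o payP T).

Let T0 : 0 <= T.
Proof. by apply: ltW; rewrite -ts0; exact: ts_ltT. Qed.

Section one_solution.
Variables (g : R -> R -> R -> R) (V M : R -> Omega -> R).
Hypothesis V_adapted : adapted F T V.
Hypothesis M_mart : ui_martingale Pr F T M.
Hypothesis V_eq : backward_equation Pr T ts payP payR g V M.

Lemma right_limit_martingale_part i s : ts i < s <= next_date T ts i ->
  {ae Pr, forall w, right_limit V (ts i) w = V s w - (M s w - M (ts i) w)}.
Proof.
move=> h; have [_ _ _ Mc] := M_mart; apply: filterS2 Mc V_eq => w Mw Vw.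
have [+ _] := @right_limit_step _ _ _ _ _ _ ts0 ts_incr ts_max_lt
  payP payR V M g w Mw Vw i.
exact.
Qed.

Lemma exercise_step i :
  {ae Pr, forall w, V (ts i) w = right_limit V (ts i) w +
      g (payP (ts i) w) (payR (ts i) w) (right_limit V (ts i) w)}.
Proof.
have [_ _ _ Mc] := M_mart; apply: filterS2 Mc V_eq => w Mw Vw.
by have [_] := @right_limit_step _ _ _ _ _ _ ts0 ts_incr ts_max_lt
  payP payR V M g w Mw Vw i.
Qed.

Lemma terminal_value : {ae Pr, forall w, V T w = payP T w}.
Proof.
apply: filterS V_eq => w /(_ T) ->; last by rewrite T0 lexx.
by rewrite subrr subr0 big_pred0 ?addr0// => i; apply/andP => -[]; lra.
Qed.

(** Integrating right_limit V (ts i) = V n - (M n - M (ts i)), with n the next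
    date, over an event of F (ts i) kills the martingale increment. Measurability
    holds because the same formula at every u in (ts i, n] makes the right limit
    F u-measurable, and the filtration is right continuous. *)
Lemma right_limit_condexp i :
  Pr.-integrable setT (EFin \o V (next_date T ts i)) ->
  is_condexp Pr (F (ts i)) (V (next_date T ts i)) (right_limit V (ts i)).
Proof.
move=> iV; have [Ma Mce _ _] := M_mart.
have i0 := ts_ge0 ts0 ts_incr i; have ni := ts_lt_next ts_incr ts_max_lt i.
have nT := next_date_le ts_incr ts_max_lt i.
set n := next_date T ts i in iV ni nT *.
have n0 : 0 <= n by lra.
have mrl : measurable_wrt (F (ts i)) (right_limit V (ts i)).
  apply: (measurable_wrt_right hF i0 ni) => u uin; have /andP[iu un] := uin.
  have u0 : 0 <= u by lra.
  apply: (measurable_wrt_ae_eq hF u0 _ (right_limit_martingale_part uin)).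
  apply: measurable_funB; first by apply: V_adapted; lra.
  apply: measurable_funB; first by apply: Ma; lra.
  apply/(measurable_wrtP (filtration_sigma_algebra hF u0)) => B mB.
  apply: (filtration_nondecreasing hF i0 (ltW iu)).
  have [+ _] := measurable_wrtP (filtration_sigma_algebra hF i0) (M (ts i)).
  by apply=> //; apply: Ma; lra.
have rlE := right_limit_martingale_part (introT andP (conj ni (lexx n))).
have iMn : Pr.-integrable setT (EFin \o M n) by have [] := Mce n n n0 (lexx n) nT.
have [_ iMi eM] := Mce (ts i) n i0 (ltW ni) nT.
have iMM : Pr.-integrable setT (EFin \o (fun w => M n w - M (ts i) w)).
  by have := integrableB measurableT iMn iMi.
have iVM : Pr.-integrable setT (EFin \o (fun w => V n w - (M n w - M (ts i) w))).
  by have := integrableB measurableT iV iMM.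
have irl : Pr.-integrable setT (EFin \o right_limit V (ts i)).
  apply: (integrable_ae_bound _ (integrable_norm iVM)).
    exact: (measurable_wrt_filtration hF i0).
  by apply: filterS rlE => w ->.
split=> // A FA; have mA := filtration_measurable hF i0 FA.
have restr X : Pr.-integrable setT (EFin \o X) -> Pr.-integrable A (EFin \o X).
  by apply: integrableS.
transitivity (\int[Pr]_(w in A) ((V n w)%:E - (M n w - M (ts i) w)%:E))%E.
  apply: ae_eq_integral => //.
  - exact: measurable_int (restr _ irl).
  - exact: measurable_int (restr _ iVM).
  - by apply: filterS rlE => w -> _; rewrite EFinB.
rewrite integralB_EFin//; [|exact: restr|exact: restr].
rewrite [X in (_ - X)%E](_ : _ = 0%E) ?sube0//.
transitivity (\int[Pr]_(w in A) ((M n w)%:E - (M (ts i) w)%:E))%E => //.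
rewrite integralB_EFin//; [|exact: restr|exact: restr].
by rewrite eM// subee//; apply: integrable_fin_num => //; exact: restr.
Qed.

Hypothesis g_le : forall p r v, `|g p r v| <= `|p - v| + `|v - r|.

Lemma integrable_at_date i :
  Pr.-integrable setT (EFin \o right_limit V (ts i)) ->
  Pr.-integrable setT (EFin \o V (ts i)).
Proof.
move=> irl; have i0 := ts_ge0 ts0 ts_incr i.
have iS := integrableD measurableT (integrable_norm irl)
  (integrableD measurableT (integrable_normB (iP i) irl)
    (integrable_normB irl (iR i))).
apply: (integrable_ae_bound (X := fun w => `|right_limit V (ts i) w| +
  (`|payP (ts i) w - right_limit V (ts i) w| +
   `|right_limit V (ts i) w - payR (ts i) w|)) _ iS).
  apply: (measurable_wrt_filtration hF i0); apply: V_adapted.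
  by rewrite i0 ltW// ts_ltT.
apply: filterS (exercise_step i) => w ->.
by rewrite (le_trans (ler_normD _ _))// lerD2l.
Qed.

(** Backward induction from V T = payP T, alternating [right_limit_condexp] and
    [integrable_at_date]. *)
Lemma integrable_next_date i : Pr.-integrable setT (EFin \o V (next_date T ts i)).
Proof.
have [k ik] : exists k, (i + k = N)%N by exists (N - i)%N; rewrite subnKC// -ltnS.
elim: k i ik => [|k IH] i ik.
  rewrite addn0 in ik; rewrite /next_date ik ltnn.
  apply: (integrable_ae_bound _ (integrable_norm iPT)).
    by apply: (measurable_wrt_filtration hF T0); apply: V_adapted; rewrite T0/=.
  by apply: filterS terminal_value => w ->.
have : (i < i + k.+1)%N by rewrite addnS ltnS leq_addr.
rewrite ik => iN.
rewrite /next_date iN; apply: integrable_at_date.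
by have [] := right_limit_condexp (IH (inord i.+1) _); rewrite ?inordK ?addSnnS.
Qed.

(** V and its right limits thus form a backward recursion by conditional
    expectations, for every reflection term g of linear growth. *)
Lemma solution_condexp i :
  is_condexp Pr (F (ts i)) (V (next_date T ts i)) (right_limit V (ts i)).
Proof. exact: right_limit_condexp (integrable_next_date i). Qed.

End one_solution.

Section two_solutions.
Variables V M : R -> Omega -> R.
Hypothesis V_adapted : adapted F T V.
Hypothesis M_mart : ui_martingale Pr F T M.
Hypothesis V_eq : backward_equation Pr T ts payP payR (@reflection R) V M.

(** The parameter-free factor in [entropy_reflection_bound], evaluated on the
    limiting value V. *)
Definition step_error (i : 'I_N.+1) (w : Omega) : R :=
  2 + `|payP (ts i) w - right_limit V (ts i) w| +
      `|right_limit V (ts i) w - payR (ts i) w|.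

Definition future_error (i : 'I_N.+1) (w : Omega) : R :=
  \sum_(j < N.+1 | (i < j)%N) step_error j w.

Lemma step_error_ge0 i w : 0 <= step_error i w.
Proof. by rewrite /step_error !addr_ge0. Qed.

Lemma future_error_ge0 i w : 0 <= future_error i w.
Proof. by apply: sumr_ge0 => j _; exact: step_error_ge0. Qed.

Let condV := solution_condexp V_adapted
  M_mart V_eq (@reflection_le R).

Let intV := integrable_next_date V_adapted
  M_mart V_eq (@reflection_le R).

Lemma integrable_step_error i : Pr.-integrable setT (EFin \o step_error i).
Proof.
have [_ iv _] := condV i.
have i2 : Pr.-integrable setT (EFin \o (cst 2 : Omega -> R)).
  exact: finite_measure_integrable_cst.
by have := integrableD measurableT (integrableD measurableT i2 (integrable_normB (iP i) iv))
  (integrable_normB iv (iR i)).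
Qed.

Lemma integrable_future_error i : Pr.-integrable setT (EFin \o future_error i).
Proof.
have := @integrable_sum _ _ _ Pr _ measurableT _ (index_enum 'I_N.+1)
  (fun j => i < j)%N (fun j => EFin \o step_error j) (fun j _ => integrable_step_error j).
by congr (integrable _ _ _); apply/funext => w; rewrite /= sumEFin.
Qed.

Variables (l : R) (Vl Ml : R -> Omega -> R).
Hypothesis l0 : 0 < l.
Hypothesis Vl_sol : is_entropy_solution Pr F T ts payP payR l Vl Ml.

Let Vl_adapted : adapted F T Vl. Proof. by have [[]] := Vl_sol. Qed.
Let Ml_mart : ui_martingale Pr F T Ml. Proof. by have [] := Vl_sol. Qed.
Let Vl_eq : backward_equation Pr T ts payP payR (entropy_reflection l) Vl Ml.
Proof. by have [] := Vl_sol. Qed.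

Let condVl := solution_condexp Vl_adapted
  Ml_mart Vl_eq (fun p r v => entropy_reflection_le p r v l0).

Let intVl := integrable_next_date Vl_adapted
  Ml_mart Vl_eq (fun p r v => entropy_reflection_le p r v l0).

Lemma measurable_right_limit_gap i : measurable_wrt (F (ts i))
  (fun w => right_limit Vl (ts i) w - right_limit V (ts i) w).
Proof.
by apply: measurable_funB; [have [] := condVl i|have [] := condV i].
Qed.

(** Passing through the entropic step evaluated at the limiting value v keeps
    the error term independent of Vl. *)
Lemma exercise_gap i : {ae Pr, forall w, `|Vl (ts i) w - V (ts i) w| <=
  `|right_limit Vl (ts i) w - right_limit V (ts i) w| + Num.sqrt l * step_error i w}.
Proof.
apply: filterS2 (exercise_step Ml_mart Vl_eq i)
  (exercise_step M_mart V_eq i) => w -> ->.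
set p := payP _ _; set r := payR _ _; set v := right_limit V _ _.
set v' := right_limit Vl _ _.
have -> : v' + entropy_reflection l p r v' - (v + reflection p r v) =
  ((v' + entropy_reflection l p r v') - (v + entropy_reflection l p r v)) +
  (entropy_reflection l p r v - reflection p r v) by ring.
apply: le_trans (ler_normD _ _) _; apply: lerD.
  exact: entropy_step_lip.
exact: entropy_reflection_bound.
Qed.

(** Backward induction on the date: [condexp_norm_le] bounds the gap at ts i by
    the gap at the next date over the same event, which also belongs to the larger
    sigma-algebra there, and [exercise_gap] adds one error term. At T the gap
    vanishes. *)
Lemma right_limit_gap_bound i (A : set Omega) : F (ts i) A ->
  (\int[Pr]_(w in A) `|right_limit Vl (ts i) w - right_limit V (ts i) w|%:E <=
   (Num.sqrt l)%:E * \int[Pr]_(w in A) (future_error i w)%:E)%E.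
Proof.
have [k ik] : exists k, (i + k = N)%N by exists (N - i)%N; rewrite subnKC// -ltnS.
elim: k i ik A => [|k IH] i ik A FA; have i0 := ts_ge0 ts0 ts_incr i;
  have mA := filtration_measurable hF i0 FA;
  have gap := condexp_norm_le (filtration_sigma_algebra hF i0)
    (filtration_measurable hF i0) (intV i) (intVl i) (condV i) (condVl i) FA;
  apply: le_trans gap _.
  have -> : (\int[Pr]_(w in A)
      `|Vl (next_date T ts i) w - V (next_date T ts i) w|%:E = 0)%E.
    transitivity (\int[Pr]_(w in A) (cst 0 w : \bar R))%E; last exact: integral0.
    apply: ae_eq_integral => //.
      have := integrableB measurableT (intVl i) (intV i).
      by move=> /(@integrable_norm _ _ _ _ _ (fun w => _ w - _ w)) /measurable_int;
        exact: measurable_funTS.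
    rewrite addn0 in ik; rewrite /next_date ik ltnn.
    apply: filterS2 (terminal_value Vl_eq)
      (terminal_value V_eq) => w -> -> _.
    by rewrite subrr normr0.
  rewrite mule_ge0 ?lee_fin ?sqrtr_ge0//.
  by apply: integral_ge0 => w _; rewrite lee_fin future_error_ge0.
have : (i < i + k.+1)%N by rewrite addnS ltnS leq_addr.
rewrite ik => iN.
pose j : 'I_N.+1 := inord i.+1.
have jE : j = i.+1 :> nat by rewrite inordK.
have nj : next_date T ts i = ts j by rewrite /next_date iN.
have FjA : F (ts j) A.
  apply: (filtration_nondecreasing hF i0) FA.
  by apply: (ts_le ts_incr); rewrite jE.
have jk : (j + k)%N = N by rewrite jE addSnnS.
have restr X : Pr.-integrable setT (EFin \o X) -> Pr.-integrable A (EFin \o X).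
  by apply: integrableS.
have iD : Pr.-integrable setT
    (EFin \o (fun w => `|right_limit Vl (ts j) w - right_limit V (ts j) w|)).
  have [_ iv' _] := condVl j; have [_ iv _] := condV j.
  apply: (@integrable_norm _ _ _ _ _ (fun w => _ w - _ w)).
  by have := integrableB measurableT iv' iv.
have is_ : Pr.-integrable setT (EFin \o (fun w => Num.sqrt l * step_error j w)).
  by have := integrableZl measurableT (Num.sqrt l) (integrable_step_error j).
apply: (@le_trans _ _ (\int[Pr]_(w in A)
    ((`|right_limit Vl (ts j) w - right_limit V (ts j) w|)%:E +
     (Num.sqrt l * step_error j w)%:E))%E).
  rewrite nj; apply: ae_ge0_le_integral => //.
  - have := integrableB measurableT (intVl i) (intV i); rewrite nj.
    by move=> /(@integrable_norm _ _ _ _ _ (fun w => _ w - _ w)) /measurable_int;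
      exact: measurable_funTS.
  - by move=> w _; rewrite -EFinD lee_fin addr_ge0// mulr_ge0// step_error_ge0.
  - by have := measurable_int _ (integrableD mA (restr _ iD) (restr _ is_)).
  - by apply: filterS (exercise_gap j) => w h _; rewrite -EFinD lee_fin.
rewrite integralD_EFin//; [|exact: restr|exact: restr].
apply: le_trans (leeD (IH j jk A FjA) (lexx _)) _.
rewrite [X in (_ + X <= _)%E](_ : _ =
  \int[Pr]_(w in A) ((Num.sqrt l)%:E * (step_error j w)%:E))%E//.
rewrite integralZl//; last exact: restr (integrable_step_error j).
rewrite -ge0_muleDr; [|by apply: integral_ge0 => w _; rewrite lee_fin future_error_ge0
  |by apply: integral_ge0 => w _; rewrite lee_fin step_error_ge0].
rewrite -integralD_EFin//; [|exact: restr (integrable_future_error j)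
  |exact: restr (integrable_step_error j)].
rewrite le_eqVlt; apply/orP; left; apply/eqP; congr (_ * _)%E.
apply: eq_integral => w _; rewrite -EFinD; congr EFin.
rewrite [in RHS]/future_error (bigD1 j)/= ?jE// addrC; congr (_ + _).
apply: eq_bigl => m; rewrite -(inj_eq val_inj)/= jE.
by rewrite ltn_neqAle eq_sym andbC.
Qed.

End two_solutions.

End backward_equations.

(** * Almost sure convergence of the stopping times *)

(** If f were further than e from a at some small l, then by continuity it would
    be so on a neighbourhood of l, which meets S. *)
Lemma dense_within_cvg {R : realType} (S : set R) (f : R -> R) (a : R) :
  dense S -> (forall l, 0 < l -> {for l, continuous f}) ->
  f l @[l --> within S 0^'+] --> a -> f l @[l --> 0^'+] --> a.
Proof.
move=> dS cf /cvgrPdist_le fa; apply/cvgrPdist_le => e e0.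
have := fa _ e0; rewrite near_withinE => /nbhs_ballP[r /= r0 hr].
near=> l.
have l0 : 0 < l by near: l; exact: nbhs_right_gt.
have lr : l < r by near: l; exact: nbhs_right_lt.
rewrite leNgt; apply/negP => el.
have nl : \forall x \near l, [/\ 0 < x, x < r & e < `|a - f x|].
  near=> x; split; near: x.
  - exact: lt_nbhsr.
  - exact: lt_nbhsl.
  - have : `|a - f x| @[x --> l] --> `|a - f l|.
      by apply: cvg_norm; apply: cvgB; [exact: cvg_cst|exact: cf].
    by move=> /cvgr_gt; apply.
have /dS/(_ (open_interior _))[x [xi Sx]] :
    interior [set x | [/\ 0 < x, x < r & e < `|a - f x|]] !=set0.
  by exists l.
have [x0 xr ex] := interior_subset xi.
have := hr x; rewrite /ball/= sub0r normrN gtr0_norm// => /(_ xr x0 Sx).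
by rewrite leNgt ex.
Unshelve. all: by end_near. Qed.

Lemma uniform01_itvoo {R : realType} {d : measure_display}
    {Omega : measurableType d} (Pr : probability Omega R) (U : {RV Pr >-> R}) :
  uniform01 U -> {ae Pr, forall w, 0 < U w < 1}.
Proof.
move=> hU; have mA : measurable (~` `]0, 1[%classic : set R) by exact: measurableC.
exists (U @^-1` (~` `]0, 1[)); split.
- by rewrite -[X in measurable X]setTI; exact: measurable_funP.
- have := hU _ mA; rewrite /distribution /pushforward => ->.
  rewrite /uniform_prob integral_uniform_pdf.
  have A01 : ~` `]0, 1[ `&` `[0, 1] `<=` [set 0; 1 : R].
    move=> x /= [/negP + /=]; rewrite !in_itv/= => h /andP[x0 x1].
    move: h; rewrite !lt_neqAle x0 x1 !andbT negb_and !negbK.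
    by case/orP => /eqP ->; [left|right].
  apply: null_set_integral.
  - exact: measurableI.
  - by apply/measurable_EFinP/measurable_funTS; exact: measurable_uniform_pdf.
  - apply: countable_lebesgue_measure0; apply: sub_countable.
      exact: subset_card_le A01.
    by apply: finite_set_countable; exact: finite_set2.
- by move=> w /= + h; apply; move: h; rewrite in_itv.
Qed.

Lemma integrable_payoff {R : realType} {d : measure_display}
    {Omega : measurableType d} (Pr : probability Omega R) (X : Omega -> R) :
  measurable_fun setT X -> {ae Pr, forall w, 0 <= X w} ->
  ('E_Pr[X] < +oo)%E -> Pr.-integrable setT (EFin \o X).
Proof.
move=> mX X0 EX; apply/integrableP; split; first exact/measurable_EFinP.
apply: le_lt_trans EX; rewrite expectation.unlock le_eqVlt; apply/orP; left.
apply/eqP/ae_eq_integral => //.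
- by apply: measurableT_comp => //; exact/measurable_EFinP.
- exact/measurable_EFinP.
by apply: filterS X0 => w X0w _; rewrite /= ger0_norm.
Qed.

Theorem theorem4p2 (R : realType) (d : measure_display)
  (Omega : measurableType d) (Pr : probability Omega R)
  (F : R -> set_system Omega) (hF : usual_filtration Pr F)
  (T : R) (hT : 0 < T)
  (N : nat) (ts : 'I_N.+1 -> R) (ts0 : ts ord0 = 0)
  (ts_incr : forall i j : 'I_N.+1, (i < j)%N -> ts i < ts j)
  (ts_lt : ts ord_max < T)
  (payP payR : R -> Omega -> R)
  (payP_adapted : adapted F T payP) (payR_adapted : adapted F T payR)
  (payP_ge0 : forall t, 0 <= t <= T -> {ae Pr, forall w, 0 <= payP t w})
  (payP_lt_payR : forall i, {ae Pr, forall w, payP (ts i) w < payR (ts i) w})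
  (payR_T : {ae Pr, forall w, payR T w = payP T w})
  (payP_fin : forall u, exercise_dates T ts u -> ('E_Pr[payP u] < +oo)%E)
  (payR_fin : forall u, exercise_dates T ts u -> ('E_Pr[payR u] < +oo)%E)
  (V M : R -> Omega -> R)
  (V_value : is_game_value Pr F T ts payP payR V)
  (M_mart : ui_martingale Pr F T M)
  (V_eq : backward_equation Pr T ts payP payR (@reflection R) V M)
  (Vl Ml : R -> R -> Omega -> R)
  (Vl_sol : forall lambda, 0 < lambda ->
     is_entropy_solution Pr F T ts payP payR lambda (Vl lambda) (Ml lambda))
  (U1 U2 : {RV Pr >-> R})
  (U1_unif : uniform01 U1) (U2_unif : uniform01 U2)
  (U_indep : mutually_independent3 Pr U1 U2 (filtration_oo F))
  (nullP : Pr.-negligible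
     (\bigcup_(i : 'I_N.+1) [set w | right_limit V (ts i) w = payP (ts i) w]))
  (nullR : Pr.-negligible
     (\bigcup_(i : 'I_N.+1) [set w | right_limit V (ts i) w = payR (ts i) w])) :
  forall t, 0 <= t <= T ->
    (forall L : set R, countable L ->
       {ae Pr, forall w,
         (fun lambda =>
            (entropy_buyer T ts payP lambda (Vl lambda) U1 t w,
             entropy_seller T ts payR lambda (Vl lambda) U2 t w))
           @ within L 0^'+ -->
         (optimal_buyer T ts payP V t w, optimal_seller T ts payR V t w)})
    /\
    (lambda_continuous Pr ts Vl ->
       {ae Pr, forall w,
         (fun lambda =>
            (entropy_buyer T ts payP lambda (Vl lambda) U1 t w,
             entropy_seller T ts payR lambda (Vl lambda) U2 t w))
           @ 0^'+ -->
         (optimal_buyer T ts payP V t w, optimal_seller T ts payR V t w)}).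

Proof.
move=> t /andP[_ tT].
have i0 := ts_ge0 ts0 ts_incr.
have iT i : 0 <= ts i <= T by rewrite i0 ltW// ts_ltT.
have T0 : 0 <= T by exact: ltW.
have iP i : Pr.-integrable setT (EFin \o payP (ts i)).
  apply: (integrable_payoff _ (payP_ge0 _ (iT i))).
    exact: (measurable_wrt_filtration hF (i0 i) (payP_adapted _ (iT i))).
  by apply: payP_fin; left; exists i.
have iR i : Pr.-integrable setT (EFin \o payR (ts i)).
  apply: integrable_payoff.
  - exact: (measurable_wrt_filtration hF (i0 i) (payR_adapted _ (iT i))).
  - by apply: filterS2 (payP_ge0 _ (iT i)) (payP_lt_payR i) => w /le_lt_trans h /h /ltW.
  - by apply: payR_fin; left; exists i.
have iPT : Pr.-integrable setT (EFin \o payP T).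
  have TT : 0 <= T <= T by rewrite T0 lexx.
  apply: (integrable_payoff _ (payP_ge0 _ TT)).
    exact: (measurable_wrt_filtration hF T0 (payP_adapted _ TT)).
  by apply: payP_fin; right.
have V_adapted : adapted F T V by case: V_value.
(* The null set depends on L: it collects those of the parameters in L. *)
have right_limits_cvg (L : set R) : countable L -> {ae Pr, forall w, forall i,
    right_limit (Vl l) (ts i) w @[l --> within L 0^'+] --> right_limit V (ts i) w}.
  move=> cL; apply: filter_forall => i.
  have FE := filtration_sigma_algebra hF (i0 i).
  have gap_cvg0 : {ae Pr, forall w, right_limit (Vl l) (ts i) w -
      right_limit V (ts i) w @[l --> within L 0^'+] --> (0 : R)}.
    apply: (countable_family_cvg0 FE (filtration_measurable hF (i0 i)) cL
      (H := future_error ts payP payR V i)).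
    - move=> l l0; exact: (measurable_right_limit_gap hF ts0 ts_incr ts_lt iP iR iPT
        V_adapted M_mart V_eq l0 (Vl_sol _ l0)).
    - exact: (integrable_future_error hF ts0 ts_incr ts_lt iP iR iPT
        V_adapted M_mart V_eq).
    - exact: future_error_ge0.
    - move=> l A l0; exact: (right_limit_gap_bound hF ts0 ts_incr ts_lt iP iR iPT
        V_adapted M_mart V_eq l0 (Vl_sol _ l0)).
  apply: filterS gap_cvg0 => w gapw.
  rewrite -[X in _ --> X]add0r.
  under eq_fun do rewrite -(subrK (right_limit V (ts i) w) (right_limit (Vl _) _ _)).
  by apply: cvgD => //; exact: cvg_cst.
(* Both parts follow from convergence of the right limits along the
   corresponding filter of parameters. *)
have reduction (G : set_system R) : Filter G -> G --> 0^'+ ->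
    {ae Pr, forall w, forall i,
      right_limit (Vl l) (ts i) w @[l --> G] --> right_limit V (ts i) w} ->
    {ae Pr, forall w,
      (fun lambda =>
        (entropy_buyer T ts payP lambda (Vl lambda) U1 t w,
         entropy_seller T ts payR lambda (Vl lambda) U2 t w)) @ G -->
      (optimal_buyer T ts payP V t w, optimal_seller T ts payR V t w)}.
  move=> FG G0 cvgG.
  have PR : {ae Pr, forall w, forall i, payP (ts i) w < payR (ts i) w}.
    exact: filter_forall.
  have VE : {ae Pr, forall w, forall i, V (ts i) w = right_limit V (ts i) w +
      reflection (payP (ts i) w) (payR (ts i) w) (right_limit V (ts i) w)}.
    by apply: filter_forall => i; exact: (exercise_step ts0 ts_incr ts_lt M_mart V_eq).
  have VT := terminal_value ts0 ts_incr ts_lt V_eq.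
  have nP : {ae Pr, forall w, forall i, right_limit V (ts i) w != payP (ts i) w}.
    apply: negligibleS nullP => w /= h; apply: contrapT => h'; apply: h => i.
    by apply/eqP => e; apply: h'; exists i.
  have nR : {ae Pr, forall w, forall i, right_limit V (ts i) w != payR (ts i) w}.
    apply: negligibleS nullR => w /= h; apply: contrapT => h'; apply: h => i.
    by apply/eqP => e; apply: h'; exists i.
  near=> w; apply: cvg_near_cst.
  have cw : forall i, right_limit (Vl l) (ts i) w @[l --> G] --> right_limit V (ts i) w.
    by near: w.
  have PRw : forall i, payP (ts i) w < payR (ts i) w by near: w.
  have VEw : forall i, V (ts i) w = right_limit V (ts i) w +
      reflection (payP (ts i) w) (payR (ts i) w) (right_limit V (ts i) w) by near: w.
  have VTw : V T w = payP T w by near: w.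
  have RTw : payR T w = payP T w by near: w.
  have nPw : forall i, right_limit V (ts i) w != payP (ts i) w by near: w.
  have nRw : forall i, right_limit V (ts i) w != payR (ts i) w by near: w.
  have U1w : 0 < U1 w < 1 by near: w; exact: uniform01_itvoo.
  have U2w : 0 < U2 w < 1 by near: w; exact: uniform01_itvoo.
  have buyer := entropy_buyer_near ts_incr ts_lt FG tT G0 U1w PRw VEw VTw cw nPw.
  have seller := entropy_seller_near ts_incr ts_lt FG tT G0 U2w PRw VEw VTw cw RTw nRw.
  by apply: filterS2 buyer seller => l -> ->.
split=> [L cL|cont].
  apply: reduction (right_limits_cvg L cL).
  by apply: cvg_within.
apply: reduction => //.
(* Rational parameters: countable, and dense enough for continuous versions. *)
have cQ : countable (@ratr R @` setT).
  by apply: sub_countable (countableP [set: rat]); exact: card_image_le.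
apply: filterS2 (right_limits_cvg _ cQ) cont => w cvgw contw i.
by apply: (dense_within_cvg (@dense_rat R)) (cvgw i) => l l0; exact: contw.
Unshelve. all: by end_near. Qed.
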